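(* Let $\varphi : \mathbf S \to \mathbf T$ be a surjective homomorphism of specialization posets (or semilattices) with $0$, and suppose that every closed element of $\mathbf T$ has a maximal preimage in $\mathbf S$. If $\mathbf S$ is compact, then $\mathbf T$ is compact.
   Context: A specialization poset is a structure $(S, \leq, \sqsubseteq)$ with $(S, \leq)$ a poset and $\sqsubseteq$ a binary relation such that (S1) $a \leq b$ implies $a \sqsubseteq b$, and (S2) $a \sqsubseteq b$ and $b \sqsubseteq c$ imply $a \sqsubseteq c$. A specialization semilattice is $(S, \vee, \sqsubseteq)$ with $(S,\vee)$ a join-semilattice (order: $a \leq b$ iff $a \vee b = b$), satisfying (S1), (S2) and (S3) $a \sqsubseteq b$ and $a_1 \sqsubseteq b$ imply $a \vee a_1 \sqsubseteq b$. An element $c$ is closed if, for every $a \in S$, $a \sqsubseteq c$ implies $a \leq c$. A specialization poset (semilattice) with $0$ is one with a $\leq$-minimum element $0$ which is closed, i.e. $a \sqsubseteq 0$ implies $a = 0$. A homomorphism of specialization posets (semilattices) preserves $\leq$ (resp. $\vee$) and $\sqsubseteq$. A homomorphism $\varphi : \mathbf S \to \mathbf T$ of specialization posets or semilattices with $0$ is moreover required to satisfy $\varphi(0_{\mathbf S}) = 0_{\mathbf T}$ and: if $a \in S$ and $a \neq 0_{\mathbf S}$, then $\varphi(a) \neq 0_{\mathbf T}$. An element $t \in T$ has maximal preimage if the set $\{s \in S \mid \varphi(s) \leq_{\mathbf T} t\}$ has a maximum element. A family $D$ of elements has meet $0$ if $0$ is the only common lower bound of the elements of $D$. A specialization poset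 (semilattice) with $0$ is compact if, for every family $D$ of closed elements with meet $0$, there is a finite subfamily $D_F \subseteq D$ with meet $0$. *)

(* Defs.v *)
From HB Require Import structures.
From mathcomp Require Import all_boot all_order.
From mathcomp Require Import boolp classical_sets functions cardinality.

Set Implicit Arguments.
Unset Strict Implicit.
Unset Printing Implicit Defensive.

Import Order.TTheory.
Local Open Scope classical_set_scope.
Local Open Scope order_scope.

HB.mixin Record POrder_isSpecPOrder (d : Order.disp_t) S
    of Order.POrder d S := {
  spec : S -> S -> Prop;
  spec_le : forall a b : S, a <= b -> spec a b;
  spec_trans : forall a b c : S, spec a b -> spec b c -> spec a c
}.

#[short(type="specPOrderType")]
HB.structure Definition SpecPOrder (d : Order.disp_t) :=
  { S of POrder_isSpecPOrder d S & Order.POrder d S }.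

Notation "a ⊑ b" := (spec a b) (at level 70, no associativity) : order_scope.

HB.mixin Record SpecPOrder_isSpecSemilattice (d : Order.disp_t) S
    of SpecPOrder d S & Order.JoinSemilattice d S := {
  spec_join : forall a a1 b : S, a ⊑ b -> a1 ⊑ b -> a `|` a1 ⊑ b
}.

(* By leEjoin, the order appearing in spec_le is the one defined by the join. *)
#[short(type="specSemilatticeType")]
HB.structure Definition SpecSemilattice (d : Order.disp_t) :=
  { S of SpecPOrder_isSpecSemilattice d S & SpecPOrder d S
       & Order.JoinSemilattice d S }.

Definition spec_closed (d : Order.disp_t) (S : specPOrderType d) (c : S) :=
  forall a : S, a ⊑ c -> a <= c.

HB.mixin Record SpecPOrder_hasClosedBottom (d : Order.disp_t) S
    of SpecPOrder d S & Order.BPOrder d S := {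
  bot_closed : spec_closed (\bot : S)
}.

#[short(type="specPOrder0Type")]
HB.structure Definition SpecPOrder0 (d : Order.disp_t) :=
  { S of SpecPOrder_hasClosedBottom d S & SpecPOrder d S
       & Order.BPOrder d S }.

#[short(type="specSemilattice0Type")]
HB.structure Definition SpecSemilattice0 (d : Order.disp_t) :=
  { S of SpecSemilattice d S & SpecPOrder0 d S }.

Record specPOrder_hom (d d' : Order.disp_t)
    (S : specPOrderType d) (T : specPOrderType d') (phi : S -> T) : Prop := {
  specPOrder_hom_le : {homo phi : a b / a <= b};
  specPOrder_hom_spec : {homo phi : a b / a ⊑ b}
}.

Record specSemilattice_hom (d d' : Order.disp_t)
    (S : specSemilatticeType d) (T : specSemilatticeType d')
    (phi : S -> T) : Prop := {
  specSemilattice_hom_join : {morph phi : a b / a `|` b};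
  specSemilattice_hom_spec : {homo phi : a b / a ⊑ b}
}.

Record zero_hom (d d' : Order.disp_t)
    (S : specPOrder0Type d) (T : specPOrder0Type d') (phi : S -> T) : Prop := {
  zero_hom_bot : phi \bot = \bot;
  zero_hom_neq_bot : forall a : S, a <> \bot -> phi a <> \bot
}.

Record specPOrder0_hom (d d' : Order.disp_t)
    (S : specPOrder0Type d) (T : specPOrder0Type d') (phi : S -> T) : Prop := {
  specPOrder0_hom_hom : specPOrder_hom phi;
  specPOrder0_hom_zero : zero_hom phi
}.

Record specSemilattice0_hom (d d' : Order.disp_t)
    (S : specSemilattice0Type d) (T : specSemilattice0Type d')
    (phi : S -> T) : Prop := {
  specSemilattice0_hom_hom : specSemilattice_hom phi;
  specSemilattice0_hom_zero : zero_hom phi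
}.

Definition has_maximal_preimage (d d' : Order.disp_t)
    (S : porderType d) (T : porderType d') (phi : S -> T) (t : T) : Prop :=
  let P := [set s : S | phi s <= t] in exists m : S, P m /\ ubound P m.

Definition has_meet0 (d : Order.disp_t) (S : bPOrderType d) (D : set S) : Prop :=
  lbound D = [set \bot].

(* A family is taken as its set of members: meets only depend on this set. *)
Definition spec_compact (d : Order.disp_t) (S : specPOrder0Type d) : Prop :=
  forall D : set S, D `<=` [set c | spec_closed c] -> has_meet0 D ->
  exists DF : set S, [/\ DF `<=` D, finite_set DF & has_meet0 DF].

(* Main.v *)
Require Import Defs.
From HB Require Import structures.
From mathcomp Require Import all_boot all_order.
From mathcomp Require Import boolp classical_sets functions cardinality.

(** Sending a closed element [t] of the target to the maximum [m] of
    [{s | phi s <= t}] behaves like a right adjoint of [phi] on closed elements: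
    [phi s <= t] if and only if [s <= m]. This turns lower bounds in one
    structure into lower bounds in the other, and [m] is again closed because
    [phi] preserves specialization ([maximal_preimage_closed]).

    Given closed elements of the target with meet [0], their maximal preimages
    are closed; they have meet [0], because a common lower bound [s] gives a
    common lower bound [phi s] of the original elements, so that [phi s = 0],
    and only [0] is sent to [0]. Compactness of the source selects finitely many
    of these preimages. The corresponding elements of the target have meet [0]:
    by surjectivity a common lower bound is some [phi s], and then [s] lies below
    the selected preimages, so [s = 0] and [phi s = 0].

    Joins enter only through the order, which is why posets and semilattices
    share one argument ([spec_compact_image]). *)

Set Implicit Arguments.
Unset Strict Implicit.
Unset Printing Implicit Defensive.

Import Order.TTheory.
Local Open Scope classical_set_scope.
Local Open Scope order_scope.

Definition maximal_preimage (d d' : Order.disp_t)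
    (S : porderType d) (T : porderType d') (phi : S -> T) (t : T) (m : S) :=
  phi m <= t /\ ubound [set s : S | phi s <= t] m.

Lemma has_meet0P (d : Order.disp_t) (S : bPOrderType d) (D : set S) :
  has_meet0 D <-> forall x : S, lbound D x -> x = \bot.
Proof.
split=> [D0 x|D0]; first by rewrite D0.
by apply/seteqP; split=> x => [/D0//|-> y _]; exact: le0x.
Qed.

(** If [a ⊑ m], then [phi a ⊑ phi m <= t], hence [phi a <= t] as [t] is closed,
    and maximality of [m] gives [a <= m]. *)
Lemma maximal_preimage_closed (d d' : Order.disp_t)
    (S : specPOrderType d) (T : specPOrderType d') (phi : S -> T)
    (t : T) (m : S) :
  {homo phi : a b / a ⊑ b} -> spec_closed t -> maximal_preimage phi t m ->
  spec_closed m.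
Proof.
move=> phi_spec t_closed [phim_le m_max] a /phi_spec am.
apply: m_max; apply: t_closed.
exact: spec_trans _ _ _ am (spec_le _ _ phim_le).
Qed.

Lemma spec_compact_image (d d' : Order.disp_t)
    (S : specPOrder0Type d) (T : specPOrder0Type d') (phi : S -> T) :
  {homo phi : a b / a <= b} -> {homo phi : a b / a ⊑ b} -> zero_hom phi ->
  set_surj setT setT phi ->
  (forall t : T, spec_closed t -> has_maximal_preimage phi t) ->
  spec_compact S -> spec_compact T.
Proof.
move=> phi_le phi_spec [phi0 phi_neq0] phi_surj max_pre S_compact D D_closed.
move=> /has_meet0P D0.
pose E := [set m | exists2 t, D t & maximal_preimage phi t m].
have E_closed : E `<=` [set c | spec_closed c].
  by move=> m [t /D_closed t_closed]; exact: maximal_preimage_closed.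
have E0 : has_meet0 E.
  apply/has_meet0P => s s_lb; apply: contrapT => /phi_neq0; apply.
  apply: D0 => t Dt; have [m tm] := max_pre t (D_closed t Dt).
  have Em : E m by exists t.
  by case: tm => [phim_le _]; exact: le_trans (phi_le _ _ (s_lb m Em)) phim_le.
have [EF [EF_sub EF_fin /has_meet0P EF0]] := S_compact E E_closed E0.
(* Elements of [EF] are lifted back to [D]; outside [EF] the value [\bot] is
   an arbitrary default. *)
have /choice[g gP] m : exists t, EF m -> D t /\ maximal_preimage phi t m.
  have [/EF_sub[t Dt tm]|nEF] := pselect (EF m); first by exists t.
  by exists \bot.
exists (g @` EF); split; first by move=> _ [m /gP[Dt _] <-].
  exact: finite_image.
apply/has_meet0P => t; have [s _ <-] := phi_surj t I => s_lb.
rewrite -phi0; congr phi; apply: EF0 => m EFm.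
by have [_ [_ m_max]] := gP m EFm; apply: m_max; apply: s_lb; exists m.
Qed.

Lemma join_morph_homo (d d' : Order.disp_t) (S : joinSemilatticeType d)
    (T : joinSemilatticeType d') (phi : S -> T) :
  {morph phi : a b / a `|` b} -> {homo phi : a b / a <= b}.
Proof. by move=> phiU a b; rewrite !leEjoin -phiU => /eqP->. Qed.

Unset Implicit Arguments.
Local Close Scope order_scope.
Local Close Scope classical_set_scope.

Theorem theorem6p4 :
  (forall (d d' : Order.disp_t) (S : specPOrder0Type d) (T : specPOrder0Type d')
      (phi : S -> T),
    specPOrder0_hom phi ->
    set_surj setT setT phi ->
    (forall t : T, spec_closed t -> has_maximal_preimage phi t) ->
    spec_compact S -> spec_compact T)
  /\
  (forall (d d' : Order.disp_t) (S : specSemilattice0Type d)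
      (T : specSemilattice0Type d') (phi : S -> T),
    specSemilattice0_hom phi ->
    set_surj setT setT phi ->
    (forall t : T, spec_closed t -> has_maximal_preimage phi t) ->
    spec_compact S -> spec_compact T).
Proof.
split=> d d' S T phi [[phi1 phi_spec] phi_zero]; apply: spec_compact_image => //.
exact: join_morph_homo.
Qed.
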